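(* Let $\Omega\subset\mathbb{C}$ be a non-empty open set with connected components $\{A_i\}_{i\in I}$. Let $(X,\|\cdot\|)$ be a non-trivial Banach space of holomorphic functions on $\Omega$ such that: the constant function $1$ belongs to $X$; every point-evaluation functional is bounded (for each $z\in\Omega$ there is $C(z)>0$ with $|f(z)|\le C(z)\|f\|$ for all $f\in X$); and for every $g\in X$, each function $g\chi_{A_i}$ (equal to $g$ on $A_i$ and $0$ on $\Omega\setminus A_i$) belongs to $X$ and $\sum_{i\in I}\|g\chi_{A_i}\|<\infty$. Let $\phi$ be holomorphic on $\Omega$ such that $M_\phi f=\phi f$ defines a bounded operator $M_\phi:X\to X$. Then the following are equivalent: (1) $M_\phi$ is recurrent; (2) $M_\phi$ is rigid; (3) $\phi$ is constant on each $A_i$ and $|\phi(z)|=1$ for all $z\in\Omega$; (4) $M_\phi$ is hyper-recurrent; (5) $\mathrm{Hr}(M_\phi)$ is dense in $X$.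
   Context: For a bounded operator $T$ on a Banach space $X$: $x$ is recurrent if $T^{\omega_n}x\to x$ for some strictly increasing sequence $(\omega_n)$ of positive integers; $\mathrm{Rec}(T)$ is the set of recurrent vectors and $T$ is recurrent if $\mathrm{Rec}(T)$ is dense. $\mathfrak{C}$ is the set of strictly increasing sequences $\omega$ with $T^{\omega_n}x\to x$ for some $x\ne0$; $\mathfrak{L}(\omega)=\{x:T^{\omega_n}x\to x\}$. $T$ is rigid if $\mathfrak{L}(\omega)=X$ for some $\omega\in\mathfrak{C}$. $\mathrm{Hr}(T)$ is the set of $x\in\mathrm{Rec}(T)$ such that $\mathfrak{L}(\omega)$ is dense for every $\omega\in\mathfrak{C}$ with $x\in\mathfrak{L}(\omega)$; a recurrent $T$ is hyper-recurrent if $\mathrm{Hr}(T)\ne\emptyset$. *)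

(* Defs.v *)
From HB Require Import structures.
From mathcomp Require Import all_boot all_order all_algebra.
From mathcomp Require Import all_classical all_reals all_analysis.
From mathcomp Require Import complex.
Set Implicit Arguments. Unset Strict Implicit. Unset Printing Implicit Defensive.
Import Order.TTheory GRing.Theory Num.Theory.
Import numFieldNormedType.Exports.
Local Open Scope classical_set_scope.
Local Open Scope ring_scope.

Section Recurrence.
Context (K : numFieldType) (V : normedModType K).

Definition incr_pos_seq (w : nat -> nat) : Prop :=
  (0 < w 0)%N /\ forall m n : nat, (m < n)%N -> (w m < w n)%N.

Definition Lset (T : V -> V) (w : nat -> nat) : set V :=
  [set x | (fun n => iter (w n) T x) @ \oo --> x].

Definition recurrent_vector (T : V -> V) (x : V) : Prop :=
  exists2 w, incr_pos_seq w & Lset T w x.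

Definition Rec (T : V -> V) : set V := [set x | recurrent_vector T x].

Definition recurrent (T : V -> V) : Prop := dense (Rec T).

Definition Cfam (T : V -> V) : set (nat -> nat) :=
  [set w | incr_pos_seq w /\ exists2 x, x != 0 & Lset T w x].

Definition rigid (T : V -> V) : Prop :=
  exists2 w, Cfam T w & Lset T w = setT.

Definition Hr (T : V -> V) : set V :=
  [set x | Rec T x /\ forall w, Cfam T w -> Lset T w x -> dense (Lset T w)].

Definition hyper_recurrent (T : V -> V) : Prop :=
  recurrent T /\ Hr T !=set0.

End Recurrence.

(* the complex numbers over a real field R (R : realType), packaged as a
   numClosedFieldType so that MathComp-Analysis gives it its normed topology *)
Definition Cplx (R : realType) : numClosedFieldType := R[i].

Section Complex.
Context (R : realType).
Local Notation C := (Cplx R).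

Definition holomorphic_on (O : set C) (f : C -> C) : Prop :=
  forall z, O z -> derivable f z 1.

Definition components (O : set C) : set (set C) :=
  [set A | exists2 x, O x & A = connected_component O x].

End Complex.

(* Main.v *)
Require Import Defs.
From HB Require Import structures.
From mathcomp Require Import all_boot all_order all_algebra.
From mathcomp Require Import all_classical all_reals all_analysis.
From mathcomp Require Import complex finmap ring lra.
Import Order.TTheory GRing.Theory Num.Theory.
Import numFieldNormedType.Exports.
Local Open Scope classical_set_scope.
Local Open Scope ring_scope.
Local Open Scope complex_scope.
Set Implicit Arguments. Unset Strict Implicit.

(** If [M_phi] is recurrent, evaluating a recurrent vector close to [1] at [z]
    gives [phi(z)^(w n) -> 1], so [|phi| = 1] on [O]; a unimodular holomorphic
    function has zero derivative, hence is constant on each component.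

    Conversely, let [phi] be a unimodular constant [c_A] on each component [A].
    Summability of the norms of the indicators [1 chi_A], all nonzero, makes the
    components countable, and Dirichlet's simultaneous approximation gives one
    sequence [w] with [c_A^(w n) -> 1] for all [A].  Since
    [M_phi^m f - f = sum_A (c_A^m - 1) f chi_A] is dominated by the summable
    family [2 |f chi_A|], any such [w] satisfies [M_phi^(w n) f -> f] for every
    [f].  If [f] vanishes identically on no component, every [w] returning [f]
    is of this kind, so [f] is hyper-recurrent; and [f + t 1] is such a function
    for all but countably many [t]. *)

(** * Vanishing derivatives and local constancy *)

Lemma derive0_of_norm1 (K : numFieldType) (phi : K -> K) (z : K) :
  derivable phi z 1 -> (\forall y \near z, `|phi y| = 1) -> 'D_1 phi z = 0.
Proof.
move=> dphi phi1; set a := 'D_1 phi z; apply/eqP/negPn/negP => a0.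
have phiz1 : `|phi z| = 1 by exact: (nbhs_singleton phi1).
have phiz0 : phi z != 0 by rewrite -normr_gt0 phiz1 ltr01.
have a_gt0 : 0 < `|a| / 2 by rewrite divr_gt0 ?normr_gt0.
have /cvgrPdist_lt/(_ _ a_gt0) := dphi.
rewrite near_withinE -/a => near1.
have near2 : \forall h \near (0 : K), `|phi (h + z)| = 1.
  by move: phi1; rewrite (near_shift 0 z) subr0 => phi1.
have /nbhs_ballP[e /= e0 He] : \forall h \near (0 : K), (h != 0 ->
    `|a - h^-1 *: ((phi \o shift z) (h *: 1) - phi z)| < `|a| / 2) /\ `|phi (h + z)| = 1.
  by apply: filterS2 near1 near2 => h h1 h2; split.
(* Move in the direction [h] with [a h = t (phi z)]: to first order this
   multiplies [phi z] by [1 + t], leaving the unit circle. *)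
pose t := e * `|a| / 2; pose h := t * phi z / a.
have t0 : 0 < t by rewrite !mulr_gt0 ?normr_gt0 ?invr_gt0.
have h0 : h != 0.
  by apply: mulf_neq0; [apply: mulf_neq0 => //; rewrite gt_eqF|rewrite invr_neq0].
have na0 : `|a| != 0 by rewrite normr_eq0.
have nh : `|h| = e / 2.
  by rewrite /h 2!normrM normfV phiz1 mulr1 (gtr0_norm t0) /t mulrAC mulfK.
have [] := He h.
  by rewrite -ball_normE /= sub0r normrN nh ltr_pdivrMr// ltr_pMr// ltr1n.
move=> /(_ h0) /= + phih.
rewrite [h *: 1]mulr1 => E.
have : `|a * h - (phi (h + z) - phi z)| < t / 2.
  have -> : a * h - (phi (h + z) - phi z) = h * (a - h^-1 *: (phi (h + z) - phi z)).
    by rewrite mulrBr [h * (h^-1 *: _)]mulVKf// mulrC.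
  rewrite normrM nh (_ : t / 2 = e / 2 * (`|a| / 2)); last by rewrite /t mulrACA mulrA.
  by rewrite ltr_pM2l// divr_gt0.
have -> : a * h = t * phi z by rewrite mulrC /h divfK.
rewrite opprB addrA -{2}(mul1r (phi z)) -mulrDl => H.
(* The moduli [1 + t] and [1] differ by [t], yet the two points lie within [t / 2] of each other. *)
have := lerB_dist ((t + 1) * phi z) (phi (h + z)).
rewrite phih normrM phiz1 mulr1 gtr0_norm ?addr_gt0// addrK => /le_lt_trans/(_ H).
rewrite ltr_pdivlMr// => /lt_trans/(_ (_ : t < t * 2)).
by rewrite ltxx ltr_pMr// ltr1n => /(_ isT).
Qed.

Lemma derive0_le (K : numFieldType) (phi : K -> K) (z : K) :
  derivable phi z 1 -> 'D_1 phi z = 0 ->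
  forall e, 0 < e -> exists2 d, 0 < d &
    forall h, `|h| < d -> `|phi (h + z) - phi z| <= e * `|h|.
Proof.
move=> dphi phi0 e e0; have /cvgrPdist_le/(_ _ e0) := dphi.
rewrite near_withinE -[lim _]/('D_1 phi z) phi0 => /nbhs_ballP[d /= d0 He].
exists d => // h hd; have [->|h0] := eqVneq h 0.
  by rewrite add0r subrr !normr0 mulr0.
have := He h; rewrite -ball_normE /= sub0r normrN => /(_ hd h0).
rewrite sub0r normrN [h *: 1]mulr1 [_ *: _]/(_ * _) normrM normfV mulrC.
by rewrite ler_pdivrMr ?normr_gt0.
Qed.

(** [P] stands for the real or the imaginary part. Compatibility with differences and the bound by
    the modulus suffice to carry [derive0_le] over to a real function of a real variable. *)
Lemma is_derive0_path (R : realType) (phi : Cplx R -> Cplx R) (z v : Cplx R)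
    (P : Cplx R -> R) (t : R) :
  {morph P : x y / x - y} -> (forall x, (`|P x|)%:C <= `|x|) ->
  derivable phi (z + t%:C * v) 1 -> 'D_1 phi (z + t%:C * v) = 0 ->
  is_derive t (1 : R) (fun s : R => P (phi (z + s%:C * v))) 0.
Proof.
move=> PB Ple dphi phi0.
suff H : (fun h : R => h^-1 *: (P (phi (z + (h *: 1 + t)%:C * v))
    - P (phi (z + t%:C * v)))) @ 0^' --> (0 : R).
  by apply: DeriveDef; [apply/cvgP: H | exact/cvg_lim].
apply/cvgrPdist_le => e e0; rewrite near_withinE.
(* Adding 1 keeps [V] positive when [v = 0], so that [e / V] and [d / V] are usable. *)
pose V : R := complex.Re (`|v| + 1).
have VE : V%:C = `|v| + 1 by rewrite RRe_real// realD.
have V0 : 0 < V by rewrite -ltcR VE ltr_wpDl.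
have eV : 0 < (e / V)%:C :> Cplx R by rewrite ltcR divr_gt0.
have [d d0 dP] := derive0_le dphi phi0 eV.
have dE : (complex.Re d)%:C = d by rewrite RRe_real// gtr0_real.
have Rd0 : 0 < complex.Re d by rewrite -ltcR dE.
apply/nbhs_ballP; exists (complex.Re d / V) => /=; first by rewrite divr_gt0.
move=> h; rewrite -ball_normE /= sub0r normrN ltr_pdivlMr// => hd h0.
have nh : `|h%:C * v| <= (`|h| * V)%:C :> Cplx R.
  rewrite normrM rmorphM/= VE normc_def /= expr0n addr0 sqrtr_sqr.
  by rewrite ler_wpM2l ?ler0c// lerDl.
rewrite sub0r normrN [_ *: _]/(_ * _) normrM normfV mulrC ler_pdivrMr ?normr_gt0//.
rewrite -PB -lecR (le_trans (Ple _))// [h *: 1]mulr1.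
have -> : z + (h + t)%:C * v = h%:C * v + (z + t%:C * v).
  by rewrite (rmorphD (real_complex R)) mulrDl addrCA.
apply: (le_trans (dP _ _)).
  by rewrite -dE (le_lt_trans nh)// ltcR.
rewrite (le_trans (ler_wpM2l (ltW eV) nh))// -rmorphM lecR.
by rewrite mulrCA divfK ?gt_eqF// mulrC.
Qed.

(** The mean value theorem holds for real-valued functions only, so it is applied to the real and
    imaginary parts along the segment separately. *)
Lemma derive0_segment (R : realType) (phi : Cplx R -> Cplx R) (z w : Cplx R) :
  (forall t : R, 0 <= t <= 1 -> derivable phi (z + t%:C * (w - z)) 1 /\
    'D_1 phi (z + t%:C * (w - z)) = 0) ->
  phi z = phi w.
Proof.
move=> dphi.
have main (P : Cplx R -> R) : {morph P : x y / x - y} ->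
    (forall x, (`|P x|)%:C <= `|x|) -> P (phi z) = P (phi w).
  move=> PB Ple; pose F (s : R) := P (phi (z + s%:C * (w - z))).
  have dF (t : R) : 0 <= t <= 1 -> is_derive t (1 : R) F 0.
    by move=> /dphi[d1 d2]; exact: (is_derive0_path PB Ple d1 d2).
  have [|||c _] := @MVT_segment R F (fun=> 0) 0 1 => //.
  - by move=> x; rewrite in_itv /= => /andP[x0 x1]; apply: dF; rewrite !ltW.
  - apply: derivable_within_continuous => x; rewrite in_itv /= => x01.
    by have [] := dF x x01.
  rewrite mul0r /F mul0r mul1r addr0 subrKC => /eqP.
  by rewrite subr_eq0 => /eqP ->.
have Re_eq : complex.Re (phi z) = complex.Re (phi w).
  apply: main => [[a b] [c d]//|x].
  by rewrite (le_trans _ (normc_ge_Re x)).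
have Im_eq : complex.Im (phi z) = complex.Im (phi w).
  apply: main => [[a b] [c d]//|[a b]].
  by rewrite normc_def lecR -sqrtr_sqr ler_wsqrtr//= lerDr sqr_ge0.
by move: Re_eq Im_eq; case: (phi z) (phi w) => [a b] [c d] /= -> ->.
Qed.

(** Inside [O] both the level set of [f x] and its complement are open, so the level set is
    relatively clopen in the connected set [A]. *)
Lemma connected_locally_constant (T : topologicalType) (U : Type) (O A : set T) (f : T -> U) :
  open O -> A `<=` O -> connected A ->
  (forall x, O x -> \forall y \near x, f y = f x) ->
  forall x y, A x -> A y -> f x = f y.
Proof.
move=> oO AO cA fO x y Ax Ay.
have nbO z : O z -> nbhs z O by move=> Oz; exact: open_nbhs_nbhs.
suff AE : A `&` (O `&` [set z | f z = f x]) = A.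
  by move: Ay; rewrite -AE => -[_ [_ /= ->]].
apply: cA; first by exists x; split => //; split => //; exact: AO.
- exists (O `&` [set z | f z = f x]) => //.
  rewrite openE => z [Oz /= fz]; apply: filterI; first exact: nbO.
  by apply: filterS (fO z Oz) => u /= ->.
- exists (~` (O `&` [set z | f z <> f x])).
    apply: open_closedC; rewrite openE => z [Oz /= fz].
    by apply: filterI; [exact: nbO|apply: filterS (fO z Oz) => u /= ->].
  apply/seteqP; split=> z /=.
    by case=> Az [Oz fz]; split => // -[].
  case=> Az H; split => //; split; first exact: AO.
  by apply: contrapT => fz; apply: H; split => //; exact: AO.
Qed.

(** * Countability and simultaneous Dirichlet approximation *)

Lemma pigeonhole_nat (F : finType) (g : nat -> F) :
  exists i j, (i < j)%N /\ g i = g j.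
Proof.
pose u (i : 'I_#|F|.+1) := g i.
have /injectivePn[i [j ij uij]] : ~~ injectiveb u.
  by apply/negP => /injectiveP/leq_card; rewrite card_ord ltnn.
have [lij|lij|/val_inj eij] := ltngtP i j.
- by exists i, j.
- by exists j, i.
- by rewrite eij eqxx in ij.
Qed.

(** The support is the union over [n] of the sets where [a] exceeds [1 / (n + 1)], and summability
    makes each of these finite. *)
Lemma summable_countable_support (R : realType) (T : choiceType) (S : set T) (a : T -> R) :
  (forall x, S x -> 0 <= a x) -> (\esum_(x in S) (a x)%:E < +oo)%E ->
  countable [set x | S x /\ 0 < a x].
Proof.
move=> a0 asum.
rewrite (_ : [set _ | _] = \bigcup_n [set x | S x /\ n.+1%:R^-1 < a x]); last first.
  apply/seteqP; split=> [x [Sx /ltr_add_invr[k]]|x [k _ [Sx]]].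
    by rewrite add0r => kx; exists k.
  by move=> kx; split => //; apply: lt_trans kx; rewrite invr_gt0.
apply: bigcup_countable => // n _; apply: finite_set_countable.
apply: contrapT => infA.
have sum_ge0 : (0 <= \esum_(x in S) (a x)%:E)%E.
  by apply: esum_ge0 => x Sx; rewrite lee_fin a0.
have sumfin : \esum_(x in S) (a x)%:E \is a fin_num by rewrite ge0_fin_numE.
pose s := fine (\esum_(x in S) (a x)%:E).
(* Chosen so that [N] terms above [1 / (n + 1)] already exceed the total [s]. *)
pose N := (Num.truncn (s * n.+1%:R)).+1.
have [B BA NB] := infinite_set_fset N infA.
have : (s%:E < \esum_(x in S) (a x)%:E)%E; last by rewrite fineK// ltxx.
have leB : ((\sum_(x <- enum_fset B) a x)%:E <= \esum_(x in S) (a x)%:E)%E.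
  apply: esum_ge; exists [set` B]; first by split => // x /BA[].
  by rewrite fsbig_finite//= set_fsetK sumEFin.
apply: lt_le_trans leB; rewrite lte_fin.
apply: (@lt_le_trans _ _ (N%:R * n.+1%:R^-1)).
  by rewrite ltr_pdivlMr// truncnS_gt.
apply: (@le_trans _ _ ((size (enum_fset B))%:R * n.+1%:R^-1)).
  by rewrite ler_wpM2r// ler_nat.
rewrite mulr_natl.
have -> : n.+1%:R^-1 *+ (size (enum_fset B)) = \sum_(i <- B) (n.+1%:R^-1 : R).
  by rewrite big_const_seq count_predT iter_addr_0.
by rewrite !big_seq; apply: ler_sum => x /BA[_ /ltW].
Qed.

Lemma truncn_eq_dist (R : realType) (N : nat) (x y : R) :
  0 <= x -> 0 <= y -> Num.truncn (x * N.+1%:R) = Num.truncn (y * N.+1%:R) ->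
  `|x - y| <= N.+1%:R^-1.
Proof.
move=> x0 y0 xy; set n := N.+1%:R : R; have n0 : 0 < n by rewrite ltr0n.
have /truncn_itv := mulr_ge0 x0 (ltW n0); have /truncn_itv := mulr_ge0 y0 (ltW n0).
rewrite -/n xy -natr1 => /andP[y1 y2] /andP[x1 x2].
rewrite -(ler_pM2r n0) mulVf ?gt_eqF// -{1}(gtr0_norm n0) -normrM mulrBl.
by rewrite ler_norml; lra.
Qed.

Lemma normc_le_ReIm (R : realType) (z : Cplx R) (e : R) :
  `|complex.Re z| <= e -> `|complex.Im z| <= e -> `|z| <= (e *+ 2)%:C.
Proof.
move=> re im; rewrite (complexE z) (le_trans (ler_normD _ _))//.
rewrite mulr2n rmorphD lerD//.
  by rewrite normc_def /= expr0n addr0 sqrtr_sqr lecR.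
rewrite normrM normc_def /= expr0n add0r expr1n sqrtr1 mul1r.
by rewrite normc_def /= expr0n addr0 sqrtr_sqr lecR.
Qed.

(** Among the joint powers of the first [n] numbers, two fall into the same cells of a finite grid;
    dividing one by the other, which preserves distances as the [c k] are unimodular, brings the
    quotient close to 1. *)
Lemma dirichlet_unimodular (R : realType) (c : nat -> Cplx R) :
  (forall k, `|c k| = 1) ->
  forall n m : nat, exists w : nat, (m < w)%N /\
    forall k, (k < n)%N -> `|c k ^+ w - 1| <= (n.+1%:R^-1 *+ 2)%:C.
Proof.
move=> c1 n m.
have unim_bnd (z : Cplx R) : `|z| = 1 ->
    (0 <= complex.Re z + 1 <= 2) && (0 <= complex.Im z + 1 <= 2).
  move=> z1; have := add_Re2_Im2 z; rewrite z1 expr1n => /eqP.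
  case: z {z1} => a b /=; rewrite eq_complex /= => /andP[/eqP ab _].
  by apply/andP; split; nra.
pose T (x : R) := Num.truncn (x * n.+1%:R).
(* The endpoint [x = 2] attains the value [2 (n + 1)], hence one extra cell. *)
have T_lt x : 0 <= x <= 2 -> (T x < (n.+1 * 2).+1)%N.
  move=> /andP[x0 x2]; rewrite truncn_lt_nat ?mulr_ge0//.
  by rewrite -(natr1 (n.+1 * 2)) natrM mulrC ltr_pwDr// ler_wpM2l.
(* [col] is the cell of [z] in a grid of mesh 1/(n+1) covering the square
   [-1, 1]^2, which contains the unit circle. *)
pose col (z : Cplx R) : 'I_(n.+1 * 2).+1 * 'I_(n.+1 * 2).+1 :=
  (inord (T (complex.Re z + 1)), inord (T (complex.Im z + 1))).
have col_inj (y z : Cplx R) : `|y| = 1 -> `|z| = 1 -> col y = col z ->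
    `|y - z| <= (n.+1%:R^-1 *+ 2)%:C.
  move=> /unim_bnd/andP[y1 y2] /unim_bnd/andP[z1 z2] [].
  move=> /(congr1 val); rewrite /= !inordK ?T_lt// => re.
  move=> /(congr1 val); rewrite /= !inordK ?T_lt// => im.
  move: y1 y2 z1 z2 => /andP[y1 _] /andP[y2 _] /andP[z1 _] /andP[z2 _].
  have := truncn_eq_dist y1 z1 re; have := truncn_eq_dist y2 z2 im.
  have shiftE (a b : R) : a + 1 - (b + 1) = a - b by ring.
  rewrite !shiftE => Hi Hr; apply: normc_le_ReIm.
    by rewrite [complex.Re _](raddfB (@complex.Re R)).
  by rewrite [complex.Im _](raddfB (@complex.Im R)).
(* Only multiples of [m + 1] are used as exponents, so any positive difference of two of them
   exceeds [m]. *)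
pose g (i : nat) := [ffun k : 'I_n => col (c k ^+ (i * m.+1))].
have [i [j [ij gij]]] := pigeonhole_nat g.
exists ((j - i) * m.+1)%N; split.
  by rewrite -[X in (X <= _)%N]mul1n leq_mul// subn_gt0.
move=> k kn; have := congr1 (fun f : {ffun 'I_n -> _} => f (Ordinal kn)) gij.
rewrite !ffunE /= => /esym/col_inj.
rewrite !normrX c1 !expr1n => /(_ erefl erefl); apply: le_trans.
have -> : c k ^+ (j * m.+1) - c k ^+ (i * m.+1) =
    c k ^+ (i * m.+1) * (c k ^+ ((j - i) * m.+1) - 1).
  by rewrite mulrBr mulr1 -exprD -mulnDl subnKC// ltnW.
by rewrite normrM normrX c1 expr1n mul1r.
Qed.

(** * Norm-summable series and return times *)

(** Norms in [X] are elements of [Cplx R]; this identity moves them to [R], where monotone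
    convergence and [\esum] live. *)
Lemma norm_normE (R : realType) (X : normedModType (Cplx R)) (x : X) :
  (complex.Re `|x|)%:C = `|x|.
Proof. exact/RRe_real/normr_real. Qed.

Lemma normed_tail_lt (R : realType) (X : normedModType (Cplx R))
    (h : nat -> X) (M e : Cplx R) :
  (forall n, \sum_(k < n) `|h k| <= M) -> 0 < e ->
  \forall n \near (\oo, \oo), \sum_(n.1 <= k < n.2) `|h k| < e.
Proof.
move=> hM e0; pose b n : R := complex.Re `|h n|.
have sumE m n : \sum_(m <= k < n) `|h k| = (\sum_(m <= k < n) b k)%:C.
  by rewrite (raddf_sum (real_complex R)); apply: eq_bigr => k _; exact/esym/norm_normE.
have b0 n : 0 <= b n by rewrite -ler0c norm_normE.
have eE : (complex.Re e)%:C = e by rewrite RRe_real// gtr0_real.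
have Re0 : 0 < complex.Re e by rewrite -ltcR eE.
have : cvgn (series b).
  apply: nondecreasing_is_cvgn; first exact: nondecreasing_series.
  exists (complex.Re M) => _ [n _ <-].
  have := hM n; rewrite -(big_mkord xpredT (fun k => `|h k|)) sumE.
  by rewrite lecE => /andP[].
move=> /cauchy_cvgP/cauchy_seriesP/(_ _ Re0); apply: filterS => n.
by rewrite ger0_norm ?sumr_ge0// -ltcR eE -sumE.
Qed.

Lemma series_cvg_of_bounded (R : realType) (X : completeNormedModType (Cplx R))
    (h : nat -> X) (M : Cplx R) :
  (forall n, \sum_(k < n) `|h k| <= M) ->
  exists l : X, series h @ \oo --> l.
Proof.
move=> hM; suff : cvgn (series h) by move=> /cvg_ex.
apply/cauchy_cvgP/cauchy_seriesP => e e0.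
apply: filterS (normed_tail_lt hM e0) => n.
by apply: le_lt_trans; exact: ler_norm_sum.
Qed.

Lemma norm_lim_le (K : numFieldType) (X : normedModType K) (u : nat -> X) (l : X) (M : K) :
  u @ \oo --> l -> (forall n, `|u n| <= M) -> `|l| <= M.
Proof.
move=> ul uM; have M0 : 0 <= M by exact: le_trans (uM 0%N).
rewrite real_leNgt ?normr_real ?ger0_real//; apply/negP => Ml.
have e0 : 0 < `|l| - M by rewrite subr_gt0.
have /cvgrPdist_lt/(_ _ e0)[N _ /(_ N (leqnn N))] := ul.
rewrite /= ltrBrDr => /(le_lt_trans (lerD (lexx _) (uM N))).
by move=> /(le_lt_trans (ler_normD _ _)); rewrite subrK ltxx.
Qed.

(** Diagonal construction: [w n] treats the first [n] numbers with error at most [2 / (n + 1)], and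
    each term serves as the lower bound for the next. *)
Lemma return_sequence (R : realType) (c : nat -> Cplx R) :
  (forall k, `|c k| = 1) ->
  exists2 w, incr_pos_seq w & forall k, (fun n => c k ^+ w n) @ \oo --> (1 : Cplx R).
Proof.
move=> c1.
have /choice[W WP] : forall p : nat * nat, exists w : nat, (p.2 < w)%N /\
    forall k, (k < p.1)%N -> `|c k ^+ w - 1| <= (p.1.+1%:R^-1 *+ 2)%:C.
  by move=> [n m]; exact: dirichlet_unimodular.
pose w := fix F n := if n is n'.+1 then W (n, F n') else W (0%N, 0%N).
have wS n : (w n < w n.+1)%N by have [] := WP (n.+1, w n).
exists w.
  split; first by have [] := WP (0%N, 0%N).
  exact: (homo_ltn ltn_trans wS).
move=> k; apply/cvgrPdist_lt => e e0.
have eE : (complex.Re e)%:C = e by rewrite RRe_real// gtr0_real.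
have Re0 : 0 < complex.Re e by rewrite -ltcR eE.
have /cvgrPdist_lt/(_ _ (divr_gt0 Re0 (ltr0Sn _ 1))) := @cvg_harmonic R.
apply: filterS2 (nbhs_infty_gt k) => -[//|n] kn.
rewrite sub0r normrN ger0_norm ?invr_ge0// => /= en.
rewrite distrC -eE; have [_ /(_ k kn)/le_lt_trans] := WP (n.+1, w n); apply.
by rewrite ltcR -[_ *+ 2]mulr_natr -ltr_pdivlMr.
Qed.

(** * Function spaces with bounded evaluations, cut into pieces *)

Record function_space (R : realType) (O : set (Cplx R))
    (X : normedModType (Cplx R)) (ev : X -> Cplx R -> Cplx R) : Prop := {
  ev_linear : forall (a : Cplx R) (f g : X) z, O z ->
    ev (a *: f + g) z = a * ev f z + ev g z;
  ev_inj : forall f g : X, (forall z, O z -> ev f z = ev g z) -> f = g;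
  ev_bounded : forall z, O z -> exists2 c : Cplx R, 0 < c &
    forall f : X, `|ev f z| <= c * `|f| }.

Section Evaluation.
Context (R : realType) (O : set (Cplx R)) (X : normedModType (Cplx R))
  (ev : X -> Cplx R -> Cplx R) (fs : function_space O ev).

Lemma ev0 z : O z -> ev 0 z = 0.
Proof.
move=> Oz; have := ev_linear fs (-1) 0 0 Oz.
by rewrite scaler0 addr0 mulN1r addNr.
Qed.

Lemma evD (f g : X) z : O z -> ev (f + g) z = ev f z + ev g z.
Proof. by move=> Oz; have := ev_linear fs 1 f g Oz; rewrite scale1r mul1r. Qed.

Lemma evZ (a : Cplx R) (f : X) z : O z -> ev (a *: f) z = a * ev f z.
Proof.
by move=> Oz; have := ev_linear fs a f 0 Oz; rewrite addr0 ev0// addr0.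
Qed.

Lemma evB (f g : X) z : O z -> ev (f - g) z = ev f z - ev g z.
Proof. by move=> Oz; rewrite evD// -scaleN1r evZ// mulN1r. Qed.

Lemma ev_cvg (u : nat -> X) (l : X) z : O z ->
  u @ \oo --> l -> (fun n => ev (u n) z) @ \oo --> ev l z.
Proof.
move=> Oz ul; have [c c0 evc] := ev_bounded fs Oz.
apply/cvgrPdist_lt => e e0.
have /cvgrPdist_lt/(_ _ (divr_gt0 e0 c0)) := ul.
apply: filterS => n; rewrite ltr_pdivlMr// mulrC -evB//.
exact: le_lt_trans.
Qed.

End Evaluation.

(** Here [idx] numbers the pieces of [O] and [h k] is [g] cut off to piece [k]. Completeness gives
    the series of the [h k] a limit, bounded evaluations identify its values with those of [g], and
    injectivity of [ev] makes the limit equal to [g]. *)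
Lemma norm_le_pieces (R : realType) (O : set (Cplx R)) (X : completeNormedModType (Cplx R))
    (ev : X -> Cplx R -> Cplx R) : function_space O ev ->
  forall (idx : Cplx R -> nat) (g : X) (h : nat -> X) (M : Cplx R),
  (forall k z, O z -> ev (h k) z = if idx z == k then ev g z else 0) ->
  (forall n, \sum_(k < n) `|h k| <= M) -> `|g| <= M.
Proof.
move=> fs idx g h M hE hM; have [l hl] := series_cvg_of_bounded hM.
have -> : g = l.
  apply: (ev_inj fs) => z Oz; have := ev_cvg fs Oz hl; apply: cvg_unique => //.
  (* At a fixed [z] only the piece [idx z] contributes, so the partial sums are constant once [n]
     exceeds [idx z]. *)
  apply: cvg_near_cst; apply: filterS (nbhs_infty_gt (idx z)) => n zn.
  have evsum m : ev (series h m) z = \sum_(k < m) ev (h k) z.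
    elim: m => [|m IH]; first by rewrite /series /= big_geq// big_ord0 (ev0 fs).
    by rewrite seriesSr (evD fs)// IH big_ord_recr.
  rewrite evsum (bigD1 (Ordinal zn))//= hE// eqxx big1 ?addr0// => k.
  by rewrite hE// -val_eqE /= eq_sym => /negPf ->.
apply: (norm_lim_le hl) => n; rewrite /series /= big_mkord.
by apply: le_trans (hM n); exact: ler_norm_sum.
Qed.

Lemma near_weighted_sum_lt (K : numFieldType) (u : nat -> nat -> K) (a : nat -> K) :
  (forall k, 0 <= a k) -> (forall k, u k @ \oo --> (1 : K)) ->
  forall N e, 0 < e -> \forall n \near \oo, \sum_(k < N) `|u k n - 1| * a k < e.
Proof.
move=> a0 u1; elim=> [|N IH] e e0.
  by apply: nearW => n; rewrite big_ord0.
have e20 : 0 < e / 2 by rewrite divr_gt0.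
(* The weight [a N] may vanish; adding 1 allows the division. *)
have aN0 : 0 < a N + 1 by rewrite ltr_wpDl.
have /cvgrPdist_lt/(_ _ (divr_gt0 e20 aN0)) := u1 N.
apply: filterS2 (IH _ e20) => n Hn; rewrite distrC ltr_pdivlMr// => H.
rewrite big_ord_recr /= [e]splitr ltrD//; apply: le_lt_trans H.
by rewrite ler_wpM2l// lerDl.
Qed.

(** Dominated convergence: the pieces of [iter (w n) T f - f] are [(c k ^+ w n - 1) *: h f k], of
    norm at most twice that of [h f k]. A tail estimate uniform in [n] leaves finitely many pieces,
    each tending to 0. *)
Lemma Lset_full (R : realType) (O : set (Cplx R)) (X : completeNormedModType (Cplx R))
    (ev : X -> Cplx R -> Cplx R) : function_space O ev ->
  forall (idx : Cplx R -> nat) (h : X -> nat -> X) (c : nat -> Cplx R) (T : X -> X)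
    (w : nat -> nat),
  (forall f k z, O z -> ev (h f k) z = if idx z == k then ev f z else 0) ->
  (forall f, exists M, forall n, \sum_(k < n) `|h f k| <= M) ->
  (forall f z, O z -> ev (T f) z = c (idx z) * ev f z) ->
  (forall k, `|c k| = 1) ->
  (forall k, (fun n => c k ^+ w n) @ \oo --> (1 : Cplx R)) ->
  Lset T w = setT.
Proof.
move=> fs idx h c T w hE hM TE c1 cw; apply/seteqP; split => // f _.
have TEm m z : O z -> ev (iter m T f) z = c (idx z) ^+ m * ev f z.
  by move=> Oz; elim: m => [|m IH]; rewrite ?mul1r//= TE// IH mulrA exprS.
have bound m (M : Cplx R) : (forall n, \sum_(k < n) `|c k ^+ m - 1| * `|h f k| <= M) ->
    `|iter m T f - f| <= M.
  move=> HM; apply: (@norm_le_pieces _ _ _ _ fs idx _ (fun k => (c k ^+ m - 1) *: h f k)).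
    move=> k z Oz; rewrite (evZ fs)// hE// (evB fs)// TEm//.
    by case: eqP => [->|_]; rewrite ?mulr0// mulrBl mul1r.
  by move=> n; under eq_bigr do rewrite normrZ.
have [M hfM] := hM f.
apply/cvgrPdist_le => e e0.
have e20 : 0 < e / 2 by rewrite divr_gt0.
(* The second halving absorbs the factor 2 that bounds the coefficients on the tail. *)
have e40 : 0 < e / 2 / 2 by rewrite divr_gt0.
have [[A B] /= [[N1 _ AN] [N2 _ BN]] AB] := normed_tail_lt hfM e40.
pose N := maxn N1 N2.
have tail p : (N <= p)%N -> \sum_(N <= k < p) `|h f k| < e / 2 / 2.
  move=> Np; apply: (AB (N, p)); split; [apply: AN|apply: BN] => /=.
    exact: leq_maxl.
  by rewrite (leq_trans _ Np)// leq_maxr.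
have := near_weighted_sum_lt (fun k => normr_ge0 (h f k)) cw N e20.
apply: filterS => n Hn; rewrite distrC; apply: bound => p.
pose t k := `|c k ^+ w n - 1| * `|h f k|.
have t0 k : 0 <= t k by rewrite mulr_ge0.
rewrite -/(\sum_(k < p) t k) -(big_mkord xpredT t).
(* As [p] may be below [N], non-negative terms are added up to [maxn N p] so that the sum can be
   split at [N]. *)
apply: (@le_trans _ _ (\sum_(0 <= k < maxn N p) t k)).
  rewrite [leRHS](big_cat_nat (n := p)) ?leq_maxr//= lerDl sumr_ge0//.
rewrite (big_cat_nat (n := N)) ?leq_maxl//= [e]splitr lerD//.
  by rewrite big_mkord ltW.
apply: (@le_trans _ _ (\sum_(N <= k < maxn N p) 2 * `|h f k|)).
  apply: ler_sum => k _; rewrite ler_wpM2r// (le_trans (ler_normB _ _))//.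
  by rewrite normrX c1 expr1n normr1.
by rewrite -mulr_sumr mulrC -ler_pdivlMr// ltW// tail// leq_maxl.
Qed.

(** * Consequences of recurrence for [phi] *)

(** Raising a modulus other than 1 to a positive power never brings it closer to 1, so a single
    power close enough to 1 gives a contradiction. *)
Lemma norm1_of_exprn_cvg (K : numFieldType) (z : K) (w : nat -> nat) :
  (forall n, 0 < w n)%N -> (fun n => z ^+ w n) @ \oo --> (1 : K) -> `|z| = 1.
Proof.
move=> w0 zw; apply/eqP; apply: contraT => z1.
have e0 : 0 < `|1 - `|z| |.
  by rewrite normr_gt0 subr_eq0 eq_sym.
have /cvgrPdist_lt/(_ _ e0)[N _ /(_ N (leqnn N)) /=] := zw.
move=> /(le_lt_trans (ler_dist_dist _ _)); rewrite normr1 normrX.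
move: (normr_real z) (normr_ge0 z); move: `|z| => a areal a0.
have [] := real_leP areal (ger0_real ler01) => ale.
- have aw_le : a ^+ w N <= a by rewrite ler_iXnr.
  have : 1 - a <= 1 - a ^+ w N by rewrite lerD2l lerN2.
  rewrite !ger0_norm ?subr_ge0 ?(le_trans aw_le ale)//.
  by move=> /le_lt_trans /[apply]; rewrite ltxx.
- have aw_ge : a <= a ^+ w N by rewrite ler_eXnr// ltW.
  have : a - 1 <= a ^+ w N - 1 by rewrite lerD2r.
  rewrite !(distrC 1) !ger0_norm ?subr_ge0 ?(le_trans (ltW ale) aw_ge) ?(ltW ale)//.
  by move=> /le_lt_trans /[apply]; rewrite ltxx.
Qed.

(** A ball inside [O] contains the segment from its centre to each of its points, and the derivative
    vanishes along it. *)
Lemma unimodular_locally_constant (R : realType) (O : set (Cplx R)) (phi : Cplx R -> Cplx R) :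
  open O -> holomorphic_on O phi -> (forall z, O z -> `|phi z| = 1) ->
  forall x, O x -> \forall y \near x, phi y = phi x.
Proof.
move=> oO hphi phi1 x Ox.
have d0 z : O z -> 'D_1 phi z = 0.
  move=> Oz; apply: derive0_of_norm1; first exact: hphi.
  by apply: filterS phi1 _; exact: open_nbhs_nbhs.
have /nbhs_ballP[r /= r0 rO] : nbhs x O by exact: open_nbhs_nbhs.
apply/nbhs_ballP; exists r => // y; change (`|x - y| < r -> phi y = phi x) => xy.
apply/esym/derive0_segment => t /andP[t0 t1].
have Ot : O (x + t%:C * (y - x)).
  apply: rO; change (`|x - (x + t%:C * (y - x))| < r).
  rewrite opprD addNKr normrN normrM.
  rewrite normc_def /= expr0n addr0 sqrtr_sqr ger0_norm// distrC.
  by apply: le_lt_trans xy; rewrite ler_piMl// lecR.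
by split; [exact: hphi|exact: d0].
Qed.

Lemma cvg_eigenvalue1 (K : numFieldType) (u : nat -> K) (a : K) :
  a != 0 -> (fun n => u n * a) @ \oo --> a -> u @ \oo --> (1 : K).
Proof.
move=> a0 ua; have na0 : 0 < `|a| by rewrite normr_gt0.
apply/cvgrPdist_lt => e e0.
have /cvgrPdist_lt/(_ _ (mulr_gt0 e0 na0)) := ua.
apply: filterS => n; rewrite -[X in `|X - _|]mul1r -mulrBl normrM.
by rewrite ltr_pM2r.
Qed.

(** Evaluation at [z] is a continuous eigenfunctional of [T] with eigenvalue [phi z]; the return of
    [f] is seen through it when [f] does not vanish at [z]. *)
Lemma recurrent_eigenvalue (R : realType) (O : set (Cplx R)) (X : normedModType (Cplx R))
    (ev : X -> Cplx R -> Cplx R) (phi : Cplx R -> Cplx R) (T : X -> X) :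
  function_space O ev -> (forall f z, O z -> ev (T f) z = phi z * ev f z) ->
  forall w f z, O z -> Lset T w f -> ev f z != 0 ->
  (fun n => phi z ^+ w n) @ \oo --> (1 : Cplx R).
Proof.
move=> fs TE w f z Oz Lf fz0.
have TEm m : ev (iter m T f) z = phi z ^+ m * ev f z.
  by elim: m => [|m IH]; rewrite ?mul1r//= TE// IH mulrA exprS.
have := ev_cvg fs Oz Lf; under eq_fun do rewrite TEm.
exact: (cvg_eigenvalue1 fz0).
Qed.

Lemma recurrent_unimodular (R : realType) (O : set (Cplx R)) (X : normedModType (Cplx R))
    (ev : X -> Cplx R -> Cplx R) (phi : Cplx R -> Cplx R) (T : X -> X) (f1 : X) :
  function_space O ev -> (forall f z, O z -> ev (T f) z = phi z * ev f z) ->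
  (forall z, O z -> ev f1 z = 1) -> recurrent T ->
  forall z, O z -> `|phi z| = 1.
Proof.
move=> fs TE f1E recT z Oz; have [c c0 evc] := ev_bounded fs Oz.
have ci0 : 0 < c^-1 by rewrite invr_gt0.
(* With radius [c^-1], a vector [f] vanishing at [z] would give [1 <= c * |f1 - f| < 1]. *)
have [|f [/= f1f [w [w0 winc] Lf]]] := recT (ball f1 c^-1) _ (ball_open f1 c^-1).
  by exists f1; exact: ballxx.
apply: (@norm1_of_exprn_cvg _ _ w).
  by case=> // n; rewrite (leq_trans w0)// ltnW// winc.
apply: (recurrent_eigenvalue fs TE Oz Lf).
apply/eqP => fz0; have := evc (f1 - f).
rewrite (evB fs)// f1E// fz0 subr0 normr1 => /le_lt_trans.
move: f1f; rewrite -ball_normE /= -(ltr_pM2l c0) divff ?gt_eqF//.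
by move=> H /(_ _ H); rewrite ltxx.
Qed.

(** * Density of the hyper-recurrent vectors *)

(** A countable set is Lebesgue null, whereas the interval has measure [d]. *)
Lemma exists_notin_countable (R : realType) (B : set R) (d : R) :
  countable B -> 0 < d -> exists2 t, 0 < t < d & ~ B t.
Proof.
move=> cB d0; apply: contrapT => nex.
have sub : `]0, d[ `<=` B.
  move=> t /=; rewrite in_itv /= => td; apply: contrapT => Bt.
  by apply: nex; exists t.
have := countable_lebesgue_measure0 (sub_countable (subset_card_le sub) cB).
by rewrite lebesgue_measure_itv /= lte_fin d0 sube0 => -[] /eqP; rewrite gt_eqF.
Qed.

(** Since [phi] is constant on each piece, one sample point per piece carries all its values;
    non-vanishing of a vector at the sample points is enough for every sequence returning it to
    return all of [X]. *)
Lemma unimodular_Hr_dense (R : realType) (O : set (Cplx R))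
    (X : completeNormedModType (Cplx R)) (ev : X -> Cplx R -> Cplx R)
    (phi : Cplx R -> Cplx R) (T : X -> X) (f1 : X)
    (idx : Cplx R -> nat) (h : X -> nat -> X) :
  function_space O ev -> (forall f z, O z -> ev (T f) z = phi z * ev f z) ->
  (forall z, O z -> ev f1 z = 1) -> f1 != 0 ->
  (forall f k z, O z -> ev (h f k) z = if idx z == k then ev f z else 0) ->
  (forall f, exists M, forall n, \sum_(k < n) `|h f k| <= M) ->
  (forall x y, O x -> O y -> idx x = idx y -> phi x = phi y) ->
  (forall z, O z -> `|phi z| = 1) ->
  rigid T /\ dense (Hr T).
Proof.
move=> fs TE f1E f10 hE hM phi_idx phi1.
pose pt k : Cplx R := xget 0 [set z | O z /\ idx z = k].
(* Indices not attained on [O] receive 1, which is unimodular and has constant powers. *)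
pose c k : Cplx R := if `[< O (pt k) >] then phi (pt k) else 1.
have ptP z : O z -> O (pt (idx z)) /\ idx (pt (idx z)) = idx z.
  by move=> Oz; apply: (xgetPex 0 (P := [set x | O x /\ idx x = idx z])); exists z.
have c1 k : `|c k| = 1 by rewrite /c; case: asboolP => [/phi1//|_]; rewrite normr1.
have TEc f z : O z -> ev (T f) z = c (idx z) * ev f z.
  move=> Oz; have [Opt ipt] := ptP z Oz.
  by rewrite TE// /c asboolT// (phi_idx _ _ Opt Oz ipt).
have full w : (forall k, (fun n => c k ^+ w n) @ \oo --> (1 : Cplx R)) ->
    Lset T w = setT by move=> cw; exact: (Lset_full fs hE hM TEc).
have [w winc cw] := return_sequence c1.
split.
  by exists w; [split => //; exists f1 => //; rewrite full|exact: full].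
move=> U [f Uf] oU.
have /nbhs_ballP[r /= r0 rU] : nbhs f U by exact: open_nbhs_nbhs.
have rE : (complex.Re r)%:C = r by rewrite RRe_real// gtr0_real.
have Rr0 : 0 < complex.Re r by rewrite -ltcR rE.
pose a := complex.Re `|f1|.
have a0 : 0 < a by rewrite -ltcR norm_normE normr_gt0.
(* If [f + t f1] vanishes at [pt k] for a real [t], then [t] is the value listed here at [k]. The
   bound on [t] below keeps the perturbed vector within [r] of [f]. *)
pose B := range (fun k => - complex.Re (ev f (pt k))).
have cB : countable B by exact: (sub_countable (card_image_le _ _)).
have [t /andP[t0 td] Bt] := exists_notin_countable cB (divr_gt0 Rr0 a0).
exists (f + t%:C *: f1); split.
  apply: rU; rewrite -ball_normE /= opprD addNKr normrN normrZ.
  rewrite normc_def /= expr0n addr0 sqrtr_sqr gtr0_norm//.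
  by rewrite -(norm_normE f1) -rE -rmorphM ltcR -ltr_pdivlMr.
split; first by exists w => //; rewrite full.
move=> v _ gv; rewrite full; first by move=> V [x Vx] _; exists x.
move=> k; rewrite /c; case: asboolP => [Opt|_]; last first.
  by under eq_fun do rewrite expr1n; exact: cvg_cst.
apply: (recurrent_eigenvalue fs TE Opt gv).
rewrite (evD fs)// (evZ fs)// f1E// mulr1; apply/negP => /eqP e0.
apply: Bt; exists k => //.
have := congr1 (@complex.Re R) e0.
by case: (ev f (pt k)) => x y /= /eqP; rewrite addrC addr_eq0 => /eqP ->.
Qed.

(** * Enumerating the connected components *)

(** The cut-off of [f1] to a component takes the value 1 there, so its norm is positive; summability
    then makes the components countable, and an injection into [nat] numbers them. *)
Lemma component_pieces (R : realType) (O : set (Cplx R))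
    (X : normedModType (Cplx R)) (ev : X -> Cplx R -> Cplx R) (f1 : X) :
  function_space O ev -> (forall z, O z -> ev f1 z = 1) ->
  (forall g : X, exists gchi : set (Cplx R) -> X,
      (forall A, components O A -> forall z, O z ->
         ev (gchi A) z = if `[< A z >] then ev g z else 0) /\
      (\esum_(A in components O) ((complex.Re `|gchi A|)%:E) < +oo)%E) ->
  exists (idx : Cplx R -> nat) (h : X -> nat -> X), [/\
    forall f k z, O z -> ev (h f k) z = if idx z == k then ev f z else 0,
    forall f, exists M, forall n, \sum_(k < n) `|h f k| <= M &
    forall x y, O x -> O y -> idx x = idx y -> connected_component O x y].
Proof.
move=> fs f1E /choice[gchi gchiP].
have Re_norm0 (x : X) : 0 <= complex.Re `|x| by rewrite -ler0c norm_normE.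
have compE A z : components O A -> A z -> A = connected_component O z.
  move=> [x Ox ->] xz; apply/seteqP; split=> y.
    exact/connected_component_trans/connected_component_sym.
  exact: connected_component_trans.
have countC : countable (components O).
  have [g1E sum1] := gchiP f1.
  have cs := summable_countable_support (fun A _ => Re_norm0 (gchi f1 A)) sum1.
  apply: (sub_countable _ cs).
  apply: subset_card_le => A compA; split => //.
  rewrite -ltcR norm_normE normr_gt0; apply/eqP => gA0.
  have [x Ox AE] := compA.
  have := g1E A compA x Ox; rewrite gA0 (ev0 fs)// f1E// asboolT.
    by move/eqP; rewrite eq_sym oner_eq0.
  by rewrite AE; exact: connected_component_refl.
have /countable_injP[e einj] := countC.
(* [pick] inverts the numbering [e]; numbers that [e] does not attain fail [ok] and get the zero
   piece. *)
pose pick k : set (Cplx R) := xget set0 [set A | components O A /\ e A = k].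
pose ok k := `[< components O (pick k) /\ e (pick k) = k >].
have pickE A : components O A -> pick (e A) = A /\ ok (e A).
  move=> cA.
  have PE : components O (pick (e A)) /\ e (pick (e A)) = e A.
    by apply: (xgetPex set0 (P := [set B | components O B /\ e B = e A])); exists A.
  split; last exact/asboolP.
  have [cP eP] := PE; apply: einj => //; by rewrite in_setE.
exists (fun z => e (connected_component O z)).
exists (fun f k => if ok k then gchi f (pick k) else 0); split.
- move=> f k z Oz; have cz : components O (connected_component O z) by exists z.
  case: ifPn => [/asboolP[cp ep]|nok].
    rewrite (gchiP f).1//; case: asboolP => pz; case: eqP => // H.
      by case: H; rewrite -(compE _ _ cp pz).
    case: pz; rewrite -H; have [-> _] := pickE _ cz.
    exact: connected_component_refl.
  rewrite (ev0 fs)//; case: eqP => // H; move: nok; rewrite -H.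
  by have [_ ->] := pickE _ cz.
- move=> f; have [_ fin] := gchiP f.
  set S := esum _ _ in fin.
  have S0 : (0 <= S)%E by apply: esum_ge0 => A _; rewrite lee_fin.
  exists (fine S)%:C => n.
  (* Distinct numbers passing [ok] pick distinct components, so the partial sum is a finite subsum
     of the [\esum]. *)
  pose s := [seq pick k | k <- iota 0 n & ok k].
  have us : uniq s.
    rewrite map_inj_in_uniq ?filter_uniq ?iota_uniq// => i j.
    rewrite !mem_filter => /andP[/asboolP[_ ei] _] /andP[/asboolP[_ ej] _] pij.
    by rewrite -ei pij ej.
  have -> : \sum_(k < n) `|if ok k then gchi f (pick k) else 0| =
      (\sum_(A <- s) complex.Re `|gchi f A|)%:C.
    rewrite big_map big_filter (raddf_sum (real_complex R)) [RHS]big_mkcond /=.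
    rewrite -(big_mkord xpredT (fun k => `|if ok k then gchi f (pick k) else 0|)).
    rewrite /index_iota subn0; apply: eq_bigr => k _.
    by case: ifP; rewrite ?normr0//= => _; exact/esym/norm_normE.
  rewrite lecR -lee_fin fineK ?ge0_fin_numE//; apply: esum_ge.
  exists [set` s]; first split; first exact: finite_seq.
    by move=> A /= /mapP[k]; rewrite mem_filter => /andP[/asboolP[? _] _] ->.
  by rewrite -fsbig_seq// sumEFin.
- move=> x y Ox Oy exy.
  have -> : connected_component O x = connected_component O y.
    by apply: einj => //; rewrite in_setE; [exists x|exists y].
  exact: connected_component_refl.
Qed.

Local Close Scope complex_scope.
Unset Implicit Arguments. Set Strict Implicit.

Theorem theorem5p8 (R : realType) (O : set (Cplx R))
  (X : completeNormedModType (Cplx R)) (ev : X -> Cplx R -> Cplx R)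
  (phi : Cplx R -> Cplx R) (Mphi : X -> X) :
  (* Omega is a non-empty open subset of C *)
  open O -> O !=set0 ->
  (* X is a non-trivial Banach space of holomorphic functions on Omega:
     ev identifies each element of X with a function on Omega, linearly and
     injectively, and every such function is holomorphic on Omega *)
  (exists f : X, f != 0) ->
  (forall (a : Cplx R) (f g : X) z, O z -> ev (a *: f + g) z = a * ev f z + ev g z) ->
  (forall f g : X, (forall z, O z -> ev f z = ev g z) -> f = g) ->
  (forall f : X, holomorphic_on O (ev f)) ->
  (* the constant function 1 belongs to X *)
  (exists f1 : X, forall z, O z -> ev f1 z = 1) ->
  (* point evaluations are bounded *)
  (forall z, O z -> exists2 c : Cplx R, 0 < c & forall f : X, `|ev f z| <= c * `|f|) ->
  (* g chi_{A_i} belongs to X for every component A_i, and the norms are summable *)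
  (forall g : X, exists gchi : set (Cplx R) -> X,
      (forall A, components O A -> forall z, O z ->
         ev (gchi A) z = if `[< A z >] then ev g z else 0) /\
      (\esum_(A in components O) ((complex.Re `|gchi A|)%:E) < +oo)%E) ->
  (* phi is holomorphic on Omega and M_phi f = phi f is a bounded operator on X *)
  holomorphic_on O phi ->
  (forall (f : X) z, O z -> ev (Mphi f) z = phi z * ev f z) ->
  (exists2 k : Cplx R, 0 < k & forall f : X, `|Mphi f| <= k * `|f|) ->
  [/\ (recurrent Mphi <-> rigid Mphi),
      (recurrent Mphi <->
         ((forall A, components O A -> exists c, forall z, A z -> phi z = c) /\
          (forall z, O z -> `|phi z| = 1))),
      (recurrent Mphi <-> hyper_recurrent Mphi) &
      (recurrent Mphi <-> dense (Hr Mphi))].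
Proof.
move=> oO [z0 Oz0] _ evlin evinj evhol [f1 f1E] evbnd chi hphi TE _.
have fs : function_space O ev by split.
have [idx [h [hE hM idxP]]] := component_pieces fs f1E chi.
have f10 : f1 != 0.
  apply/eqP => f10; have := f1E z0 Oz0; rewrite f10 (ev0 fs)// => /eqP.
  by rewrite eq_sym oner_eq0.
(* Every implication starting from recurrence passes through [P3]. *)
pose P3 := (forall A, components O A -> exists c, forall z, A z -> phi z = c) /\
  (forall z, O z -> `|phi z| = 1).
have rec3 : recurrent Mphi -> P3.
  move=> recM; have phi1 := recurrent_unimodular fs TE f1E recM.
  split=> // A [x Ox ->]; exists (phi x) => z xz.
  apply: (connected_locally_constant oO _ (@component_connected _ O x)) => //.
  - exact: connected_component_sub.
  - exact: unimodular_locally_constant.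
  - exact: connected_component_refl.
have main : P3 -> rigid Mphi /\ dense (Hr Mphi).
  move=> [phiA phi1]; apply: (unimodular_Hr_dense fs TE f1E f10 hE hM) => //.
  move=> x y Ox Oy /(idxP _ _ Ox Oy) xy.
  have [|c cE] := phiA (connected_component O x); first by exists x.
  by rewrite !cE//; exact: connected_component_refl.
have rigid_rec : rigid Mphi -> recurrent Mphi.
  move=> [w [winc _] Lw] U [x Ux] _; exists x; split => //; exists w => //.
  by rewrite Lw.
have Hr_rec : dense (Hr Mphi) -> recurrent Mphi.
  by move=> dH U U0 oU; have [x [Ux [Rx _]]] := dH U U0 oU; exists x.
split; split.
- by move=> /rec3/main[].
- exact: rigid_rec.
- exact: rec3.
- by move=> /main[/rigid_rec].
- move=> recM; split => //; have [_ dH] := main (rec3 recM).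
  by have [|x [_ Hx]] := dH setT _ openT; [exists f1|exists x].
- by case.
- by move=> /rec3/main[].
- exact: Hr_rec.
Qed.
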